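(* Let $G:=D^4\{(1,3),(2,3),(1,4),(2,4),(3,4)\}$ and consider the diagram consisting of $D(2)$, three copies of $D^2$ each receiving the inclusion $D(2)\hookrightarrow D^2$, and the maps $D^2\to G$ given by $(d_1,d_2)\mapsto(d_1,d_2,0,0)$, $(d_1,d_2)\mapsto(d_1,d_2,d_1d_2,0)$ and $(d_1,d_2)\mapsto(d_1,d_2,d_1d_2,d_1d_2)$ respectively. This diagram is a quasi-colimit diagram; that is, for all $\gamma_1,\gamma_2,\gamma_3:D^2\to\mathbb{R}$ whose restrictions to $D(2)$ coincide, there is a unique $\gamma:G\to\mathbb{R}$ with $\gamma(d_1,d_2,0,0)=\gamma_1(d_1,d_2)$, $\gamma(d_1,d_2,d_1d_2,0)=\gamma_2(d_1,d_2)$ and $\gamma(d_1,d_2,d_1d_2,d_1d_2)=\gamma_3(d_1,d_2)$ for all $(d_1,d_2):D^2$.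
   Context: Work in homotopy type theory. $\mathbb{R}$ is a set with a commutative unitary ring structure that is a $\mathbb{Q}$-algebra; $D:=\{d:\mathbb{R}\mid d^2=0\}$; for a finite set $\mathfrak p$ of lists of indices in $\{1,\dots,n\}$, $D^n\{\mathfrak p\}:=\{(d_1,\dots,d_n):D^n\mid d_{i_1}\cdots d_{i_k}=0\ \forall(i_1,\dots,i_k)\in\mathfrak p\}$, $D(2):=D^2\{(1,2)\}$. A Weil algebra is $\mathbb{R}[X_1,\dots,X_n]/(X_1^{m_1},\dots,X_n^{m_n},f_1,\dots,f_k)$ and $\mathrm{Spec}_{\mathbb{R}}\mathfrak W$ is the type of $\mathbb{R}$-algebra maps $\mathfrak W\to\mathbb{R}$ (the $D^n\{\mathfrak p\}$ are of this form). Axiom (Kock–Lawvere): for every Weil algebra the canonical map $\mathfrak W\to(\mathrm{Spec}_{\mathbb{R}}\mathfrak W\to\mathbb{R})$ is an equivalence. A quasi-colimit diagram is the image under $\mathrm{Spec}_{\mathbb{R}}$ of a finite limit diagram of Weil algebras; under the axiom, a finite diagram of such types is a quasi-colimit diagram iff applying $(-)\to\mathbb{R}$ yields a limit diagram. *)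

(* Defs.v *)
(* Plain Stdlib for the ring R (NO decidable equality on R: with decidable
   equality the Kock-Lawvere axiom is inconsistent); mathcomp only for the
   finite index types 'I_n and big sums. *)
From Stdlib Require Import Ring_theory List.
From mathcomp Require Import ssreflect ssrfun ssrbool eqtype ssrnat fintype bigop.
Set Implicit Arguments. Unset Strict Implicit. Unset Printing Implicit Defensive.

Record CRing := {
  car :> Type;
  rzero : car; rone : car;
  radd : car -> car -> car; rmul : car -> car -> car; ropp : car -> car;
  rth : ring_theory rzero rone radd rmul (fun x y => radd x (ropp y)) ropp (@eq car)
}.

Section Defs.
Variable R : CRing.

Fixpoint natr (k : nat) : R :=
  match k with 0 => rzero R | S k => radd (rone R) (natr k) end.

Definition is_Q_algebra : Prop :=
  forall k : nat, exists y : R, rmul (natr (S k)) y = rone R.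

Fixpoint rpow (x : R) (k : nat) : R :=
  match k with 0 => rone R | S k => rmul x (rpow x k) end.

(* ---- Polynomial ring R[X_0,...,X_{n-1}] as terms modulo the
        commutative-R-algebra identities (= the free commutative R-algebra) *)
Inductive poly (n : nat) : Type :=
| PConst : R -> poly n
| PVar : 'I_n -> poly n
| PAdd : poly n -> poly n -> poly n
| PMul : poly n -> poly n -> poly n
| POpp : poly n -> poly n.

Fixpoint ppow n (p : poly n) (k : nat) : poly n :=
  match k with 0 => PConst n (rone R) | S k => PMul p (ppow p k) end.

Fixpoint peval n (x : 'I_n -> R) (p : poly n) : R :=
  match p with
  | PConst r => r
  | PVar i => x i
  | PAdd p q => radd (peval x p) (peval x q)
  | PMul p q => rmul (peval x p) (peval x q)
  | POpp p => ropp (peval x p)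
  end.

Inductive peqv (n : nat) : poly n -> poly n -> Prop :=
| pe_refl p : peqv p p
| pe_sym p q : peqv p q -> peqv q p
| pe_trans p q r : peqv p q -> peqv q r -> peqv p r
| pe_add p p' q q' : peqv p p' -> peqv q q' -> peqv (PAdd p q) (PAdd p' q')
| pe_mul p p' q q' : peqv p p' -> peqv q q' -> peqv (PMul p q) (PMul p' q')
| pe_opp p p' : peqv p p' -> peqv (POpp p) (POpp p')
| pe_add0 p : peqv (PAdd (PConst n (rzero R)) p) p
| pe_addC p q : peqv (PAdd p q) (PAdd q p)
| pe_addA p q r : peqv (PAdd p (PAdd q r)) (PAdd (PAdd p q) r)
| pe_mul1 p : peqv (PMul (PConst n (rone R)) p) p
| pe_mulC p q : peqv (PMul p q) (PMul q p)
| pe_mulA p q r : peqv (PMul p (PMul q r)) (PMul (PMul p q) r)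
| pe_distr p q r : peqv (PMul (PAdd p q) r) (PAdd (PMul p r) (PMul q r))
| pe_oppr p : peqv (PAdd p (POpp p)) (PConst n (rzero R))
| pe_cadd a b : peqv (PConst n (radd a b)) (PAdd (PConst n a) (PConst n b))
| pe_cmul a b : peqv (PConst n (rmul a b)) (PMul (PConst n a) (PConst n b)).

(* ---- Weil algebra  W = R[X_0..X_{n-1}] / (X_i^{m_i}, f_1, ..., f_k) *)
Record WeilPresentation := {
  wn : nat;
  wm : 'I_wn -> nat;
  wf : list (poly wn)
}.
Arguments wm : clear implicits.

(* Spec_R W: R-algebra maps W -> R, i.e. points of R^n satisfying the relations *)
Definition Spec (W : WeilPresentation) : Type :=
  { x : 'I_(wn W) -> R |
    (forall i, rpow (x i) (wm W i) = rzero R) /\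
    (forall f, In f (wf W) -> peval x f = rzero R) }.

Definition in_ideal (W : WeilPresentation) (p : poly (wn W)) : Prop :=
  exists (a : 'I_(wn W) -> poly (wn W)) (bs : list (poly (wn W))),
    length bs = length (wf W) /\
    peqv p (PAdd
      (\big[@PAdd _/PConst _ (rzero R)]_(i < wn W) PMul (a i) (ppow (PVar i) (wm W i)))
      (fold_right (fun bf acc => PAdd (PMul bf.1 bf.2) acc)
                  (PConst _ (rzero R)) (combine bs (wf W)))).

(* Kock-Lawvere: the canonical map W -> (Spec W -> R), [p] |-> (x |-> p(x)),
   is a bijection (surjective, and injective on the quotient). *)
Definition KockLawvere : Prop :=
  forall W : WeilPresentation,
    (forall g : Spec W -> R, exists p : poly (wn W),
        forall x : Spec W, g x = peval (proj1_sig x) p) /\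
    (forall p : poly (wn W),
        (forall x : Spec W, peval (proj1_sig x) p = rzero R) -> in_ideal p).

Definition Dnp (n : nat) (P : list (list 'I_n)) : Type :=
  { d : 'I_n -> R |
    (forall i, rmul (d i) (d i) = rzero R) /\
    (forall l, In l P -> fold_right (fun i acc => rmul (d i) acc) (rone R) l = rzero R) }.

Definition vec4 (a b c e : R) (i : 'I_4) : R :=
  match nat_of_ord i with 0 => a | 1 => b | 2 => c | _ => e end.

End Defs.

(* Indices 1..n of the paper are 0..n-1 here. *)
Definition D2 (R : CRing) := @Dnp R 2 nil.
Definition D_2 (R : CRing) := @Dnp R 2 ((inord 0 :: inord 1 :: nil) :: nil).
Definition G_rel : list (list 'I_4) :=
  (inord 0 :: inord 2 :: nil) :: (inord 1 :: inord 2 :: nil) ::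
  (inord 0 :: inord 3 :: nil) :: (inord 1 :: inord 3 :: nil) ::
  (inord 2 :: inord 3 :: nil) :: nil.
Definition Gty (R : CRing) := @Dnp R 4 G_rel.

(* Main.v *)
Require Import Defs.
From Stdlib Require Import Ring Ring_theory List ProofIrrelevance.
From mathcomp Require Import ssreflect ssrfun ssrbool eqtype ssrnat fintype bigop.
Set Implicit Arguments. Unset Strict Implicit.

(* By Kock-Lawvere, every function on D^2 has a unique normal form
   a + b d1 + c d2 + e d1 d2, and every function on G a unique normal form
   a + b d1 + c d2 + e d1 d2 + f d3 + k d4; uniqueness comes from cancelling
   universally quantified nilsquares, which the injectivity half of the axiom
   provides after evaluating ideal memberships at the dual numbers.  Along the
   three embeddings D^2 -> G the normal form of G restricts to the normal forms
   with d1 d2-coefficients e, e + f and e + f + k.  Agreement on D(2) forces the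
   three given functions to share a, b, c, so the glued function exists with
   f = e2 - e1, k = e3 - e2, and is unique. *)

Section QuasiColimit.
Variable R : CRing.
Add Ring R_ring : (rth R).

Declare Scope cring_scope.
Local Notation "x + y" := (radd x y) : cring_scope.
Local Notation "x * y" := (rmul x y) : cring_scope.
Local Notation "x - y" := (radd x (ropp y)) : cring_scope.
Local Notation "- x" := (ropp x) : cring_scope.
Local Notation r0 := (rzero R).
Local Notation r1 := (rone R).
Local Open Scope cring_scope.

Lemma subr0_eq (x y : R) : x - y = r0 -> x = y.
Proof. by move=> Hxy; transitivity ((x - y) + y); [ring | rewrite Hxy; ring]. Qed.

Lemma rpow2 (x : R) : rpow x 2 = x * x.
Proof. rewrite /=; ring. Qed.

Definition dual_mul (p q : R * R) : R * R := (p.1 * q.1, p.1 * q.2 + p.2 * q.1).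

Fixpoint dual_eval {n} (v : 'I_n -> R * R) (p : poly R n) : R * R :=
  match p with
  | PConst r => (r, r0)
  | PVar i => v i
  | PAdd p q => ((dual_eval v p).1 + (dual_eval v q).1, (dual_eval v p).2 + (dual_eval v q).2)
  | PMul p q => dual_mul (dual_eval v p) (dual_eval v q)
  | POpp p => (- (dual_eval v p).1, - (dual_eval v p).2)
  end.

Lemma dual_eval_peqv {n} (v : 'I_n -> R * R) (p q : poly R n) :
  peqv p q -> dual_eval v p = dual_eval v q.
Proof.
induction 1; rewrite /=; try congruence;
repeat match goal with |- context [dual_eval v ?p] =>
  let a := fresh in let b := fresh in case: (dual_eval v p) => a b end;
rewrite /dual_mul /=; f_equal; ring.
Qed.

Definition monomial {n} (l : list 'I_n) : poly R n :=
  fold_right (fun i acc => PMul (PVar R i) acc) (PConst n r1) l.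

Lemma peval_monomial {n} (x : 'I_n -> R) (l : list 'I_n) :
  peval x (monomial l) = fold_right (fun i acc => x i * acc) r1 l.
Proof. by elim: l => //= i l ->. Qed.

Definition WeilDnp {n} (P : list (list 'I_n)) : WeilPresentation R :=
  @Build_WeilPresentation R n (fun _ => 2) (map (@monomial n) P).

Lemma KL_cancel_D (KL : KockLawvere R) (b : R) :
  (forall d, d * d = r0 -> b * d = r0) -> b = r0.
Proof.
move=> Hb; have [_ KLinj] := KL (@WeilDnp 1 nil).
have [a [bs [Hbs Hideal]]] : @in_ideal R (@WeilDnp 1 nil) (PMul (PConst 1 b) (PVar R ord0)).
  by apply: KLinj => -[x [Hx _]] /=; apply: Hb; rewrite -rpow2.
case: bs Hbs Hideal => [_ Hideal|//].
(* at the dual unit e the generators X^2 of the ideal evaluate to e^2 = 0 *)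
have := dual_eval_peqv (fun _ => (r0, r1)) Hideal.
rewrite big_ord_recl big_ord0 /=.
case: (dual_eval _ (a ord0)) => p q /= [_ E].
by transitivity (b * r1 + r0 * r0); [ring | rewrite E; ring].
Qed.

Lemma KL_cancel_D2 (KL : KockLawvere R) (c : R) :
  (forall u v, u * u = r0 -> v * v = r0 -> c * u * v = r0) -> c = r0.
Proof.
move=> Hc; apply: (KL_cancel_D KL) => v hv; apply: (KL_cancel_D KL) => u hu.
by rewrite -(Hc u v hu hv); ring.
Qed.

Lemma Dnp_Spec_rels {n} (P : list (list 'I_n)) (x : 'I_n -> R) :
  ((forall i, x i * x i = r0) /\
   (forall l, In l P -> fold_right (fun i acc => x i * acc) r1 l = r0)) <->
  ((forall i, rpow (x i) 2 = r0) /\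
   (forall f, In f (map (@monomial n) P) -> peval x f = r0)).
Proof.
split=> [[Hsq HP] | [Hsq HP]]; split=> [i | ].
- by rewrite rpow2.
- move=> f /in_map_iff [l [<- Hl]]; rewrite peval_monomial; exact: HP.
- by rewrite -rpow2.
- move=> l Hl; rewrite -peval_monomial; apply: HP; exact: in_map.
Qed.

Lemma KL_Dnp_poly (KL : KockLawvere R) {n} {P : list (list 'I_n)} (g : Dnp R P -> R) :
  exists p : poly R n, forall d : Dnp R P, g d = peval (proj1_sig d) p.
Proof.
have [KLsurj _] := KL (WeilDnp P).
have [p Hp] := KLsurj (fun x => g (exist _ (proj1_sig x)
                                  (proj2 (Dnp_Spec_rels P _) (proj2_sig x)))).
exists p => -[x hx].
rewrite -(Hp (exist _ x (proj1 (Dnp_Spec_rels P x) hx))) /=.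
by congr (g (exist _ x _)); apply: proof_irrelevance.
Qed.

Lemma ord2_cases (i : 'I_2) : i = inord 0 \/ i = inord 1.
Proof. by case: i => [[|[|//]] Hi]; [left | right]; apply: val_inj; rewrite /= inordK. Qed.

Lemma ord4_cases (i : 'I_4) :
  [\/ i = inord 0, i = inord 1, i = inord 2 | i = inord 3].
Proof.
case: i => [[|[|[|[|//]]]] Hi];
  [apply: Or41 | apply: Or42 | apply: Or43 | apply: Or44];
  by apply: val_inj; rewrite /= inordK.
Qed.

Definition nf2 (a b c e u v : R) : R := a + b * u + c * v + e * (u * v).

Definition nf4 (a b c e f k u v s t : R) : R := nf2 a b c e u v + f * s + k * t.

Definition G_rels (u v s t : R) : Prop :=
  [/\ u * u = r0, v * v = r0, s * s = r0, t * t = r0 &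
   [/\ u * s = r0, v * s = r0, u * t = r0, v * t = r0 & s * t = r0]].

Lemma nf2_mul (a b c e a' b' c' e' u v : R) : u * u = r0 -> v * v = r0 ->
  nf2 a b c e u v * nf2 a' b' c' e' u v =
  nf2 (a * a') (a * b' + b * a') (a * c' + c * a') (a * e' + e * a' + b * c' + c * b') u v.
Proof.
move=> huu hvv; rewrite /nf2.
transitivity (a * a' + (a * b' + b * a') * u + (a * c' + c * a') * v
   + (a * e' + e * a' + b * c' + c * b') * (u * v)
   + u * u * (b * b' + b * e' * v + e * b' * v + e * e' * v * v)
   + v * v * (c * c' + c * e' * u + e * c' * u)); first ring.
by rewrite huu hvv; ring.
Qed.

Lemma nf4_mul (a b c e f k a' b' c' e' f' k' u v s t : R) : G_rels u v s t ->
  nf4 a b c e f k u v s t * nf4 a' b' c' e' f' k' u v s t =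
  nf4 (a * a') (a * b' + b * a') (a * c' + c * a') (a * e' + e * a' + b * c' + c * b')
      (a * f' + f * a') (a * k' + k * a') u v s t.
Proof.
move=> [huu hvv hss htt [hus hvs hut hvt hst]]; rewrite /nf4 -nf2_mul // /nf2.
transitivity (nf2 a b c e u v * nf2 a' b' c' e' u v
   + (a * f' + f * a') * s + (a * k' + k * a') * t
   + u * s * (b * f' + f * b' + e * f' * v + f * e' * v)
   + u * t * (b * k' + k * b' + e * k' * v + k * e' * v)
   + v * s * (c * f' + f * c') + v * t * (c * k' + k * c')
   + s * s * (f * f') + s * t * (f * k' + k * f') + t * t * (k * k')).
  by rewrite /nf2; ring.
by rewrite hus hut hvs hvt hss hst htt /nf2; ring.
Qed.

Lemma peval_nf2 (p : poly R 2) : exists a b c e, forall x : 'I_2 -> R,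
  x (inord 0) * x (inord 0) = r0 -> x (inord 1) * x (inord 1) = r0 ->
  peval x p = nf2 a b c e (x (inord 0)) (x (inord 1)).
Proof.
rewrite /nf2; elim: p => [r | i | p [a [b [c [e Hp]]]] q [a' [b' [c' [e' Hq]]]]
  | p [a [b [c [e Hp]]]] q [a' [b' [c' [e' Hq]]]] | p [a [b [c [e Hp]]]]].
- by exists r, r0, r0, r0 => x _ _ /=; ring.
- case: (ord2_cases i) => ->.
  + by exists r0, r1, r0, r0 => x _ _ /=; ring.
  + by exists r0, r0, r1, r0 => x _ _ /=; ring.
- exists (a + a'), (b + b'), (c + c'), (e + e') => x h0 h1 /=.
  by rewrite Hp // Hq //; ring.
- eexists _, _, _, _ => x h0 h1 /=.
  by rewrite Hp // Hq //; apply: nf2_mul.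
- exists (- a), (- b), (- c), (- e) => x h0 h1 /=.
  by rewrite Hp //; ring.
Qed.

Lemma peval_nf4 (p : poly R 4) : exists a b c e f k, forall x : 'I_4 -> R,
  G_rels (x (inord 0)) (x (inord 1)) (x (inord 2)) (x (inord 3)) ->
  peval x p = nf4 a b c e f k (x (inord 0)) (x (inord 1)) (x (inord 2)) (x (inord 3)).
Proof.
elim: p => [r | i | p [a [b [c [e [f [k Hp]]]]]] q [a' [b' [c' [e' [f' [k' Hq]]]]]]
  | p [a [b [c [e [f [k Hp]]]]]] q [a' [b' [c' [e' [f' [k' Hq]]]]]]
  | p [a [b [c [e [f [k Hp]]]]]]].
- by exists r, r0, r0, r0, r0, r0 => x _ /=; rewrite /nf4 /nf2; ring.
- case: (ord4_cases i) => ->.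
  + by exists r0, r1, r0, r0, r0, r0 => x _ /=; rewrite /nf4 /nf2; ring.
  + by exists r0, r0, r1, r0, r0, r0 => x _ /=; rewrite /nf4 /nf2; ring.
  + by exists r0, r0, r0, r0, r1, r0 => x _ /=; rewrite /nf4 /nf2; ring.
  + by exists r0, r0, r0, r0, r0, r1 => x _ /=; rewrite /nf4 /nf2; ring.
- exists (a + a'), (b + b'), (c + c'), (e + e'), (f + f'), (k + k') => x h /=.
  by rewrite Hp // Hq // /nf4 /nf2; ring.
- eexists _, _, _, _, _, _ => x h /=.
  by rewrite Hp // Hq //; apply: nf4_mul.
- exists (- a), (- b), (- c), (- e), (- f), (- k) => x h /=.
  by rewrite Hp // /nf4 /nf2; ring.
Qed.

Lemma Gty_relsP (x : 'I_4 -> R) :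
  ((forall i, x i * x i = r0) /\
   (forall l, In l G_rel -> fold_right (fun i acc => x i * acc) r1 l = r0)) <->
  G_rels (x (inord 0)) (x (inord 1)) (x (inord 2)) (x (inord 3)).
Proof.
have mulr1 (y : R) : y * r1 = y by ring.
split=> [[Hsq HG] | [h0 h1 h2 h3 [h02 h12 h03 h13 h23]]].
- have Hpair i j : In (i :: j :: nil) G_rel -> x i * x j = r0.
    by move=> /HG /=; rewrite mulr1.
  split; [exact: Hsq.. | split]; apply: Hpair; rewrite /G_rel /=; tauto.
- split=> [i | l].
  + by case: (ord4_cases i) => ->.
  + by rewrite /G_rel /= => -[<-|[<-|[<-|[<-|[<-|[]]]]]]; rewrite /= mulr1.
Qed.

Lemma D2_nf2 (KL : KockLawvere R) (g : D2 R -> R) : exists a b c e, forall d : D2 R,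
  g d = nf2 a b c e (proj1_sig d (inord 0)) (proj1_sig d (inord 1)).
Proof.
have [p Hp] := KL_Dnp_poly KL g; have [a [b [c [e He]]]] := peval_nf2 p.
by exists a, b, c, e => d; rewrite Hp He //; apply: (proj1 (proj2_sig d)).
Qed.

Lemma Gty_nf4 (KL : KockLawvere R) (g : Gty R -> R) : exists a b c e f k, forall x : Gty R,
  let y := proj1_sig x in g x = nf4 a b c e f k (y (inord 0)) (y (inord 1)) (y (inord 2)) (y (inord 3)).
Proof.
have [p Hp] := KL_Dnp_poly KL g; have [a [b [c [e [f [k He]]]]]] := peval_nf4 p.
exists a, b, c, e, f, k => x /=; rewrite Hp He //.
by apply/Gty_relsP; apply: (proj2_sig x).
Qed.

Lemma nf2_inj_D_2 (KL : KockLawvere R) (a b c e a' b' c' e' : R) :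
  (forall u v, u * u = r0 -> v * v = r0 -> u * v = r0 ->
     nf2 a b c e u v = nf2 a' b' c' e' u v) ->
  [/\ a = a', b = b' & c = c'].
Proof.
move=> H; have z : r0 * r0 = r0 by ring.
have Ha : a = a'.
  by transitivity (nf2 a b c e r0 r0); [|rewrite H //]; rewrite /nf2; ring.
have Hb : b = b'.
  apply: subr0_eq; apply: (KL_cancel_D KL) => u hu.
  have hu0 : u * r0 = r0 by ring.
  transitivity (nf2 a b c e u r0 - nf2 a' b' c' e' u r0); first by rewrite /nf2 Ha; ring.
  by rewrite H //; ring.
have Hc : c = c'.
  apply: subr0_eq; apply: (KL_cancel_D KL) => v hv.
  have h0v : r0 * v = r0 by ring.
  transitivity (nf2 a b c e r0 v - nf2 a' b' c' e' r0 v); first by rewrite /nf2 Ha; ring.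
  by rewrite H //; ring.
by split.
Qed.

Lemma nf2_inj (KL : KockLawvere R) (a b c e a' b' c' e' : R) :
  (forall u v, u * u = r0 -> v * v = r0 -> nf2 a b c e u v = nf2 a' b' c' e' u v) ->
  [/\ a = a', b = b', c = c' & e = e'].
Proof.
move=> H; have [Ha Hb Hc] := nf2_inj_D_2 KL (fun u v hu hv _ => H u v hu hv).
split=> //; apply: subr0_eq; apply: (KL_cancel_D2 KL) => u v hu hv.
transitivity (nf2 a b c e u v - nf2 a' b' c' e' u v); first by rewrite /nf2 Ha Hb Hc; ring.
by rewrite H //; ring.
Qed.

Definition vec2 (u v : R) (i : 'I_2) : R := if nat_of_ord i is 0 then u else v.

Lemma vec2_0 (u v : R) : vec2 u v (inord 0) = u. Proof. by rewrite /vec2 inordK. Qed.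
Lemma vec2_1 (u v : R) : vec2 u v (inord 1) = v. Proof. by rewrite /vec2 inordK. Qed.

Lemma vec4_0 (u v s t : R) : vec4 u v s t (inord 0) = u. Proof. by rewrite /vec4 inordK. Qed.
Lemma vec4_1 (u v s t : R) : vec4 u v s t (inord 1) = v. Proof. by rewrite /vec4 inordK. Qed.
Lemma vec4_2 (u v s t : R) : vec4 u v s t (inord 2) = s. Proof. by rewrite /vec4 inordK. Qed.
Lemma vec4_3 (u v s t : R) : vec4 u v s t (inord 3) = t. Proof. by rewrite /vec4 inordK. Qed.

Lemma vec2_sq (u v : R) : u * u = r0 -> v * v = r0 -> forall i, vec2 u v i * vec2 u v i = r0.
Proof. by move=> hu hv i; case: (ord2_cases i) => ->; rewrite ?vec2_0 ?vec2_1. Qed.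

Definition D2_pt (u v : R) (hu : u * u = r0) (hv : v * v = r0) : D2 R :=
  exist _ (vec2 u v) (conj (vec2_sq hu hv) (fun l (hl : In l nil) => match hl with end)).

Lemma D_2_rel (u v : R) : u * v = r0 -> forall l, In l ((inord 0 :: inord 1 :: nil) :: nil) ->
  fold_right (fun i acc => vec2 u v i * acc) r1 l = r0.
Proof. by move=> huv l [<-|[]] /=; rewrite vec2_0 vec2_1 -huv; ring. Qed.

Definition D_2_pt (u v : R) (hu : u * u = r0) (hv : v * v = r0) (huv : u * v = r0) : D_2 R :=
  exist _ (vec2 u v) (conj (vec2_sq hu hv) (D_2_rel huv)).

Lemma vec4_Gty_rels (u v s t : R) : G_rels u v s t ->
  (forall i, vec4 u v s t i * vec4 u v s t i = r0) /\
  (forall l, In l G_rel -> fold_right (fun i acc => vec4 u v s t i * acc) r1 l = r0).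
Proof. by move=> h; apply/Gty_relsP; rewrite vec4_0 vec4_1 vec4_2 vec4_3. Qed.

Definition G_pt (u v s t : R) (h : G_rels u v s t) : Gty R :=
  exist _ (vec4 u v s t) (vec4_Gty_rels h).

Lemma G_rels_uv00 (u v : R) : u * u = r0 -> v * v = r0 -> G_rels u v r0 r0.
Proof. by move=> hu hv; split; [..|split]; rewrite // ?hu ?hv; ring. Qed.

Lemma G_rels_uvw0 (u v : R) : u * u = r0 -> v * v = r0 -> G_rels u v (u * v) r0.
Proof.
move=> hu hv.
have huuv : u * (u * v) = r0 by transitivity ((u * u) * v); [ring | rewrite hu; ring].
have hvuv : v * (u * v) = r0 by transitivity ((v * v) * u); [ring | rewrite hv; ring].
have huvuv : (u * v) * (u * v) = r0 by transitivity ((u * u) * (v * v)); [ring | rewrite hu; ring].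
by split; [..|split]; rewrite //; ring.
Qed.

Lemma G_rels_uvww (u v : R) : u * u = r0 -> v * v = r0 -> G_rels u v (u * v) (u * v).
Proof. by move=> hu hv; have [? ? ? _ [? ? _ _ _]] := G_rels_uvw0 hu hv; split; [..|split]. Qed.

Definition glues (g1 g2 g3 : D2 R -> R) (g : Gty R -> R) : Prop :=
  forall (d : D2 R) (x : Gty R),
    let d1 := proj1_sig d (inord 0) in
    let d2 := proj1_sig d (inord 1) in
    ((forall i, proj1_sig x i = vec4 d1 d2 (rzero R) (rzero R) i) -> g x = g1 d) /\
    ((forall i, proj1_sig x i = vec4 d1 d2 (rmul d1 d2) (rzero R) i) -> g x = g2 d) /\
    ((forall i, proj1_sig x i = vec4 d1 d2 (rmul d1 d2) (rmul d1 d2) i) -> g x = g3 d).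

Lemma gluesE (g1 g2 g3 : D2 R -> R) (g : Gty R -> R) : glues g1 g2 g3 g ->
  forall u v (hu : u * u = r0) (hv : v * v = r0),
  [/\ g (G_pt (G_rels_uv00 hu hv)) = g1 (D2_pt hu hv),
      g (G_pt (G_rels_uvw0 hu hv)) = g2 (D2_pt hu hv) &
      g (G_pt (G_rels_uvww hu hv)) = g3 (D2_pt hu hv)].
Proof.
move=> Hg u v hu hv; have /= := Hg (D2_pt hu hv).
rewrite vec2_0 vec2_1 => Hpt.
by split; [apply: (Hpt _).1 | apply: (Hpt _).2.1 | apply: (Hpt _).2.2].
Qed.

Lemma restrictions_agree (KL : KockLawvere R) (g g' : D2 R -> R) (a b c e a' b' c' e' : R) :
  (forall d, g d = nf2 a b c e (proj1_sig d (inord 0)) (proj1_sig d (inord 1))) ->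
  (forall d, g' d = nf2 a' b' c' e' (proj1_sig d (inord 0)) (proj1_sig d (inord 1))) ->
  (forall (x : D_2 R) (d : D2 R), (forall i, proj1_sig d i = proj1_sig x i) -> g d = g' d) ->
  [/\ a = a', b = b' & c = c'].
Proof.
move=> G G' Hres; apply: (@nf2_inj_D_2 KL a b c e a' b' c' e') => u v hu hv huv.
have := Hres (D_2_pt hu hv huv) (D2_pt hu hv) (fun _ => erefl).
by rewrite G G' /= vec2_0 vec2_1.
Qed.

Section Gluing.
Variables (a b c e1 e2 e3 : R) (g1 g2 g3 : D2 R -> R).
Hypothesis G1 : forall d, g1 d = nf2 a b c e1 (proj1_sig d (inord 0)) (proj1_sig d (inord 1)).
Hypothesis G2 : forall d, g2 d = nf2 a b c e2 (proj1_sig d (inord 0)) (proj1_sig d (inord 1)).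
Hypothesis G3 : forall d, g3 d = nf2 a b c e3 (proj1_sig d (inord 0)) (proj1_sig d (inord 1)).

Definition glued (x : Gty R) : R :=
  let y := proj1_sig x in
  nf4 a b c e1 (e2 - e1) (e3 - e2) (y (inord 0)) (y (inord 1)) (y (inord 2)) (y (inord 3)).

Lemma glues_glued : glues g1 g2 g3 glued.
Proof.
move=> d x; cbv zeta; rewrite /glued G1 G2 G3.
by split; [|split] => Hx; rewrite !Hx vec4_0 vec4_1 vec4_2 vec4_3 /nf4 /nf2; ring.
Qed.

Lemma glues_unique (KL : KockLawvere R) (g : Gty R -> R) :
  glues g1 g2 g3 g -> forall x, g x = glued x.
Proof.
move=> Hg; have [a' [b' [c' [e' [f' [k' Gf]]]]]] := Gty_nf4 KL g.
have [Ha Hb Hc He1] : [/\ a' = a, b' = b, c' = c & e' = e1].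
  apply: (nf2_inj KL) => u v hu hv; have [E _ _] := gluesE Hg hu hv.
  by move: E; rewrite Gf G1 /= vec2_0 vec2_1 vec4_0 vec4_1 vec4_2 vec4_3 => <-; rewrite /nf4; ring.
have [_ _ _ He2] : [/\ a' = a, b' = b, c' = c & e' + f' = e2].
  apply: (nf2_inj KL) => u v hu hv; have [_ E _] := gluesE Hg hu hv.
  by move: E; rewrite Gf G2 /= vec2_0 vec2_1 vec4_0 vec4_1 vec4_2 vec4_3 => <-;
     rewrite /nf4 /nf2; ring.
have [_ _ _ He3] : [/\ a' = a, b' = b, c' = c & e' + f' + k' = e3].
  apply: (nf2_inj KL) => u v hu hv; have [_ _ E] := gluesE Hg hu hv.
  by move: E; rewrite Gf G3 /= vec2_0 vec2_1 vec4_0 vec4_1 vec4_2 vec4_3 => <-;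
     rewrite /nf4 /nf2; ring.
by move=> x; rewrite Gf /glued -Ha -Hb -Hc -He1 -He2 -He3 /nf4; ring.
Qed.

End Gluing.

End QuasiColimit.

Theorem lemma5p3 (R : CRing) (HQ : is_Q_algebra R) (KL : KockLawvere R)
  (g1 g2 g3 : D2 R -> R) :
  (* the restrictions to D(2) (along D(2) -> D^2) coincide *)
  (forall (e : D_2 R) (d : D2 R),
     (forall i, proj1_sig d i = proj1_sig e i) -> g1 d = g2 d /\ g2 d = g3 d) ->
  let P := fun g : Gty R -> R =>
    forall (d : D2 R) (x : Gty R),
      let d1 := proj1_sig d (inord 0) in
      let d2 := proj1_sig d (inord 1) in
      ((forall i, proj1_sig x i = vec4 d1 d2 (rzero R) (rzero R) i) -> g x = g1 d) /\
      ((forall i, proj1_sig x i = vec4 d1 d2 (rmul d1 d2) (rzero R) i) -> g x = g2 d) /\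
      ((forall i, proj1_sig x i = vec4 d1 d2 (rmul d1 d2) (rmul d1 d2) i) -> g x = g3 d) in
  exists g : Gty R -> R, P g /\ (forall g' : Gty R -> R, P g' -> forall x, g' x = g x).
Proof.
move=> Hres P.
have [a1 [b1 [c1 [e1 G1]]]] := D2_nf2 KL g1.
have [a2 [b2 [c2 [e2 G2]]]] := D2_nf2 KL g2.
have [a3 [b3 [c3 [e3 G3]]]] := D2_nf2 KL g3.
have [? ? ?] := restrictions_agree KL G1 G2 (fun x d h => (Hres x d h).1); subst.
have [? ? ?] := restrictions_agree KL G2 G3 (fun x d h => (Hres x d h).2); subst.
eexists; split.
- exact: glues_glued G1 G2 G3.
- exact: glues_unique G1 G2 G3 KL.
Qed.
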